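(* Let $\mathcal{G}$ be a graph with persuadable nodes $1,\ldots,n$ and zealots $n+1,\ldots,n+m$ (with fixed zealot opinions), with at least one zealot ($m\ge 1$), and suppose the persuadable subgraph $\mathcal{G}_{\mathcal{P}}$ (the subgraph induced by the persuadable nodes) is connected. Fix $\delta\ge 0$. Let $\bar{\mathbf{x}}\in\mathbb{R}^n$ be the unique steady state (vector of persuadable opinions) of the SBCM with $\gamma=0$ on $\mathcal{G}$. Then there exist $\epsilon>0$ and a unique $C^1$ function $\mathbf{h}:[0,\epsilon)\to\mathbb{R}^n$ such that: (1) $\mathbf{h}(0)=\bar{\mathbf{x}}$; (2) for all $\gamma\in[0,\epsilon)$, the SBCM with parameter $\gamma$ has a unique steady state $\mathbf{x}_\gamma\in\mathbb{R}^n$, and $\mathbf{h}(\gamma)=\mathbf{x}_\gamma$; (3) for all $\gamma\in[0,\epsilon)$, the steady state $\mathbf{x}_\gamma$ is linearly stable.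
   Context: Let $\mathcal{G}$ be a finite undirected unweighted graph without self-loops, with node set $\mathcal{N}$; write $i\sim j$ if nodes $i,j$ are adjacent. The nodes are partitioned into zealots $\mathcal{Z}$ and persuadable nodes $\mathcal{P}=\mathcal{N}\setminus\mathcal{Z}$. For $\gamma,\delta\ge 0$, the influence function is $w(x_i,x_j)=\frac{1}{1+e^{\gamma(x_i-x_j)^2-\gamma\delta}}$ if $i\sim j$ and $0$ otherwise. The SBCM is $\frac{dx_i}{dt}=f_i(\mathbf{x})=\frac{\sum_j w(x_i,x_j)(x_j-x_i)}{\sum_j w(x_i,x_j)}$ for $i\in\mathcal{P}$ and $\frac{dx_i}{dt}=0$ for $i\in\mathcal{Z}$, so zealot opinions stay fixed; a steady state is a vector of persuadable opinions making all $f_i$, $i\in\mathcal{P}$, vanish (zealot opinions held at their fixed values). A steady state is linearly stable if all eigenvalues of $\mathbf{J}_{\mathcal{P}}$, the matrix of partial derivatives $\partial f_i/\partial x_j$ with $i,j\in\mathcal{P}$ evaluated at the steady state, are strictly negative. *)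

(* Defs.v *)
From HB Require Import structures.
From mathcomp Require Import all_boot all_order all_algebra.
From mathcomp Require Import all_classical all_reals all_analysis.
From mathcomp Require Import complex.
Set Implicit Arguments. Unset Strict Implicit. Unset Printing Implicit Defensive.
Import Order.TTheory GRing.Theory Num.Theory.
Import numFieldNormedType.Exports.
Local Open Scope classical_set_scope.
Local Open Scope ring_scope.

(* Nodes are 'I_(n+m): k < n persuadable (node k+1 of the paper),
   k >= n zealots.  The graph is a relation [adj] on nodes. *)

Definition simple_graph (N : nat) (adj : rel 'I_N) : Prop :=
  (forall k l, adj k l = adj l k) /\ (forall k, ~~ adj k k).

Definition persuadable_connected (n m : nat) (adj : rel 'I_(n + m)) : Prop :=
  (0 < n)%N /\
  forall i j : 'I_n, connect [rel a b : 'I_n | adj (lshift m a) (lshift m b)] i j.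

Definition opin (R : realType) (n m : nat) (x : 'I_n -> R) (z : 'I_m -> R)
  (k : 'I_(n + m)) : R :=
  match fintype.split k with inl i => x i | inr j => z j end.

Definition infl (R : realType) (N : nat) (adj : rel 'I_N) (gam delta : R)
  (k l : 'I_N) (a b : R) : R :=
  if adj k l then 1 / (1 + expR (gam * (a - b) ^+ 2 - gam * delta)) else 0.

Definition sbcm_f (R : realType) (n m : nat) (adj : rel 'I_(n + m))
  (gam delta : R) (z : 'I_m -> R) (x : 'I_n -> R) (i : 'I_n) : R :=
  let X := opin x z in
  let k := lshift m i in
  (\sum_(l < n + m) infl adj gam delta k l (X k) (X l) * (X l - X k))
  / (\sum_(l < n + m) infl adj gam delta k l (X k) (X l)).

Definition steady_state (R : realType) (n m : nat) (adj : rel 'I_(n + m))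
  (gam delta : R) (z : 'I_m -> R) (x : 'I_n -> R) : Prop :=
  forall i : 'I_n, sbcm_f adj gam delta z x i = 0.

Definition partial (R : realType) (n : nat) (g : ('I_n -> R) -> R)
  (x : 'I_n -> R) (j : 'I_n) : R :=
  derive1 (fun t : R => g (fun k => if k == j then x k + t else x k)) 0.

Definition jacobianP (R : realType) (n m : nat) (adj : rel 'I_(n + m))
  (gam delta : R) (z : 'I_m -> R) (x : 'I_n -> R) : 'M[R]_n :=
  \matrix_(i, j) partial (fun y => sbcm_f adj gam delta z y i) x j.

Definition lin_stable (R : realType) (n m : nat) (adj : rel 'I_(n + m))
  (gam delta : R) (z : 'I_m -> R) (x : 'I_n -> R) : Prop :=
  forall lam : R[i],
    eigenvalue (map_mx (fun r : R => Complex r 0) (jacobianP adj gam delta z x)) lam ->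
    lam < 0.

Definition C1_on_Ico (R : realType) (n : nat) (eps : R) (h : R -> 'I_n -> R) : Prop :=
  exists h' : R -> 'I_n -> R,
    (forall i : 'I_n,
       {within [set t : R | 0 <= t < eps], continuous (fun t => h' t i)}) /\
    (forall (i : 'I_n) (t : R), 0 <= t < eps ->
       (fun s : R => (h (t + s) i - h t i) / s) @
         (within [set s : R | s != 0 /\ 0 <= t + s < eps] (nbhs (0 : R)))
       --> h' t i).

(* Main.v *)
Require Import Defs.
From HB Require Import structures.
From mathcomp Require Import all_boot all_order all_algebra.
From mathcomp Require Import all_classical all_reals all_analysis.
From mathcomp Require Import complex ring lra.
Set Implicit Arguments. Unset Strict Implicit. Unset Printing Implicit Defensive.
Import Order.TTheory GRing.Theory Num.Theory.
Import numFieldNormedType.Exports.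
Local Open Scope ring_scope.
Local Open Scope classical_set_scope.

(* At a persuadable node the numerator of the SBCM is a sum of phi(x_j - x_i)
   over the neighbours j, with phi(u) = u w(u) odd.  Hence the difference of the
   numerators at two opinion vectors is a weighted graph Laplacian, grounded at
   the zealots, whose weights are divided differences of phi.  On the box spanned
   by the zealot opinions, which contains all steady states by the maximum
   principle, these weights are bounded below by a positive constant as soon as
   gamma is small; the Laplacian is then symmetric and coercive, with constants
   independent of gamma.  Coercivity gives uniqueness; existence, because a small
   Euler step preserves the box and decreases the sum of squared numerators
   unless it vanishes; the C^1 dependence on gamma, because difference quotients
   of the branch solve Laplacian systems whose data converge; and stability,
   because the Jacobian at a steady state is a positive diagonal matrix times
   such a Laplacian. *)

(** * Grounded weighted Laplacians *)

(** Only persuadable rows are kept. For [X] vanishing at the zealots this is a grounded Laplacian,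
    negative semidefinite when the weights are symmetric and nonnegative. *)
Definition lap (R : realType) (n m : nat) (c : 'I_(n + m) -> 'I_(n + m) -> R)
    (X : 'I_(n + m) -> R) (i : 'I_n) : R :=
  \sum_(l < n + m) c (lshift m i) l * (X l - X (lshift m i)).

Section Laplacian.
Variables (R : realType) (n m : nat).
Implicit Types (c : 'I_(n + m) -> 'I_(n + m) -> R) (X D : 'I_(n + m) -> R).
Implicit Types (x d : 'I_n -> R) (z : 'I_m -> R).

Lemma opin_lshift x z i : opin x z (lshift m i) = x i.
Proof. by rewrite /opin (unsplitK (inl i)). Qed.

Lemma opin_rshift x z j : opin x z (rshift n j) = z j.
Proof. by rewrite /opin (unsplitK (inr j)). Qed.

Lemma opinB x y z k :
  opin x z k - opin y z k = opin (fun i => x i - y i) (fun=> 0) k.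
Proof. by rewrite /opin; case: fintype.split => // j; rewrite subrr. Qed.

(** Since [D] vanishes at the zealots, the sum extends to all nodes, where exchanging [k] and [l]
    symmetrises it. *)
Lemma summation_by_parts c D X :
  (forall k l, c k l = c l k) -> (forall j, D (rshift n j) = 0) ->
  2 * (\sum_i D (lshift m i) * lap c X i) =
  - \sum_k \sum_l c k l * ((D k - D l) * (X k - X l)).
Proof.
move=> csym D0.
have -> : \sum_i D (lshift m i) * lap c X i =
          \sum_k \sum_l D k * (c k l * (X l - X k)).
  rewrite big_split_ord /= [X in _ + X]big1 ?addr0.
    by apply: eq_bigr => i _; rewrite mulr_sumr.
  by move=> j _; apply: big1 => l _; rewrite D0 mul0r.
rewrite mulr_natl mulr2n {2}exchange_big /= -big_split /= -sumrN.
apply: eq_bigr => k _; rewrite -big_split /= -sumrN; apply: eq_bigr => l _.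
by rewrite (csym l k); ring.
Qed.

(** The lower bound is uniform over the edges, so that later constants depend only on [c0] and the
    graph. *)
Definition conductance (adj : rel 'I_(n + m)) (c0 : R) c :=
  (forall k l, c k l = c l k) /\
  (forall k l, if adj k l then c0 <= c k l else c k l == 0).

Definition anchored (adj : rel 'I_(n + m)) :=
  exists i j, adj (lshift m i) (rshift n j).

Lemma path_oscillation (adj : rel 'I_(n + m)) D (s : R) (i : 'I_n) p :
  (forall k l, adj k l -> `|D k - D l| <= s) ->
  path [rel a b : 'I_n | adj (lshift m a) (lshift m b)] i p ->
  `|D (lshift m i) - D (lshift m (last i p))| <= (size p)%:R * s.
Proof.
move=> Ds; elim: p i => [|a p IH] i /=; first by rewrite subrr normr0 mul0r.
move=> /andP[/Ds Dia /IH Dap].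
rewrite -natr1 mulrDl mul1r; apply: le_trans (ler_distD (D (lshift m a)) _ _) _.
by rewrite addrC lerD.
Qed.

(** Telescope along a path from [i] to the node [i0] next to a zealot, then across that edge, where
    [D] drops to 0; [K i] counts the edges used. *)
Lemma poincare_sup (adj : rel 'I_(n + m)) :
  anchored adj -> persuadable_connected adj ->
  exists K : 'I_n -> R, (forall i, 0 <= K i) /\
  forall D s, (forall j, D (rshift n j) = 0) ->
    (forall k l, adj k l -> `|D k - D l| <= s) ->
    forall i, `|D (lshift m i)| <= K i * s.
Proof.
move=> [i0 [j0 adj0]] [_ conn].
suff /boolp.choice[K HK] : forall i, exists K : R, 0 <= K /\
    forall D s, (forall j, D (rshift n j) = 0) ->
    (forall k l, adj k l -> `|D k - D l| <= s) -> `|D (lshift m i)| <= K * s.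
  exists K; split=> [i|D s D0 Ds i]; first by have [] := HK i.
  by have [_] := HK i; apply.
move=> i; have /connectP[p pp lp] := conn i i0.
exists (size p).+1%:R; split=> // D s D0 Ds.
rewrite -natr1 mulrDl mul1r.
have := path_oscillation Ds pp; rewrite -lp => Hp.
have := Ds _ _ adj0; rewrite D0 subr0 => H0.
apply: le_trans (lerD Hp H0); apply: le_trans (ler_normD _ _).
by rewrite subrK.
Qed.

(** Each edge carries at most the whole Dirichlet energy, which bounds all edge differences and then
    [d] by [poincare_sup]. Keeping [c0] on the left leaves [K] depending on the graph alone. *)
Lemma energy_coercive (adj : rel 'I_(n + m)) :
  anchored adj -> persuadable_connected adj ->
  exists K : R, 0 < K /\
  forall (c0 : R) c d, 0 < c0 -> conductance adj c0 c ->
    c0 * \sum_i d i ^+ 2 <= - (K * \sum_i d i * lap c (opin d (fun=> 0)) i).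
Proof.
move=> anch conn; have [K [K0 HK]] := poincare_sup anch conn.
pose L := \sum_i K i ^+ 2.
have L0 : 0 <= L by apply: sumr_ge0 => i _; exact: sqr_ge0.
(* The energy [Q] below is [- (2 * A)], whence the factor 2; the summand 1 only makes the constant
   positive. *)
exists (2 * L + 1); split; first by lra.
move=> c0 c d c0_gt0 [csym cadj]; pose D : 'I_(n + m) -> R := opin d (fun=> 0).
have D0 j : D (rshift n j) = 0 by rewrite /D opin_rshift.
have := summation_by_parts D csym D0.
under eq_bigr do rewrite {1}/D opin_lshift.
pose e k l := c k l * ((D k - D l) * (D k - D l)).
rewrite -/(\sum_k \sum_l e k l); set A := \sum_i _ * lap _ _ _; set Q := \sum_k _ => AQ.
have e_ge0 k l : 0 <= e k l.
  rewrite /e; have := cadj k l; case: ifP => _; last by move=> /eqP->; rewrite mul0r.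
  by move=> /(le_trans (ltW c0_gt0)) H; rewrite mulr_ge0// -expr2 sqr_ge0.
have eQ k l : e k l <= Q.
  have -> : Q = \sum_k \sum_l e k l by [].
  apply: (@le_trans _ _ (\sum_l e k l)).
    by rewrite (bigD1 l)//= lerDl; apply: sumr_ge0 => l' _; exact: e_ge0.
  rewrite [leRHS](bigD1 k)//= lerDl.
  by do 2!apply: sumr_ge0 => ? _; exact: e_ge0.
have Q0 : 0 <= Q by do 2!apply: sumr_ge0 => ? _; exact: e_ge0.
pose s := Num.sqrt (Q / c0).
have Qc0 : 0 <= Q / c0 by rewrite divr_ge0// ltW.
have Ds k l : adj k l -> `|D k - D l| <= s.
  move=> akl; have := cadj k l; rewrite akl => ckl.
  rewrite -sqrtr_sqr ler_wsqrtr// ler_pdivlMr// mulrC.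
  apply: le_trans (eQ k l); rewrite /e -expr2 ler_wpM2r// sqr_ge0//.
have dK i : d i ^+ 2 <= K i ^+ 2 * (Q / c0).
  have := HK _ _ D0 Ds i; rewrite /D opin_lshift => H.
  rewrite -(sqr_sqrtr Qc0) -exprMn -real_normK ?num_real//.
  by rewrite ler_sqr// ?nnegrE// mulr_ge0// sqrtr_ge0.
have : \sum_i d i ^+ 2 <= L * (Q / c0) by rewrite mulr_suml ler_sum.
rewrite mulrA ler_pdivlMr// mulrC => H; apply: le_trans H _.
have -> : Q = - (2 * A) by rewrite AQ opprK.
have A0 : A <= 0 by lra.
lra.
Qed.

(** Coercivity bounds the sum of squares of [d] by its pairing with the Laplacian; Young's
    inequality lets half of that sum be absorbed. *)
Lemma lap_estimate (adj : rel 'I_(n + m)) :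
  anchored adj -> persuadable_connected adj ->
  forall c0 : R, 0 < c0 -> exists K : R, 0 < K /\
  forall c d, conductance adj c0 c ->
    \sum_i d i ^+ 2 <= K * \sum_i lap c (opin d (fun=> 0)) i ^+ 2.
Proof.
move=> anch conn c0 c0_gt0; have [K [K0 HK]] := energy_coercive anch conn.
exists ((K / c0) ^+ 2); split; first by rewrite exprn_gt0// divr_gt0.
move=> c d /(HK c0 c d c0_gt0); set r := lap c _ => H.
have {}H : \sum_i d i ^+ 2 <= - (K / c0 * \sum_i d i * r i).
  by rewrite mulrAC -mulNr ler_pdivlMr// mulrC.
(* AM-GM: - (K / c0) d r <= d^2 / 2 + (K / c0)^2 r^2 / 2 *)
have amgm : - (K / c0 * \sum_i d i * r i) <=
    2^-1 * \sum_i d i ^+ 2 + 2^-1 * ((K / c0) ^+ 2 * \sum_i r i ^+ 2).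
  rewrite !mulr_sumr -sumrN -big_split /= ler_sum// => i _.
  have := sqr_ge0 (d i + K / c0 * r i); nra.
lra.
Qed.

End Laplacian.

(** * Maximum principle, symmetry and solvability for Laplacian systems *)

Section LaplacianSystem.
Variables (R : realType) (n m : nat).
Implicit Types (c : 'I_(n + m) -> 'I_(n + m) -> R) (X : 'I_(n + m) -> R).
Implicit Types (d u v r : 'I_n -> R).

(** Testing with [D], the positive part of [X - B], which is zero at the zealots, gives zero energy.
    So [D] is constant across edges and vanishes by [poincare_sup] with [s = 0]. *)
Lemma lap_max_principle (adj : rel 'I_(n + m)) c X B :
  anchored adj -> persuadable_connected adj ->
  (forall k l, c k l = c l k) ->
  (forall k l, if adj k l then 0 < c k l else c k l == 0) ->
  (forall j, X (rshift n j) <= B) -> (forall i, lap c X i = 0) ->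
  forall i, X (lshift m i) <= B.
Proof.
move=> anch conn csym cadj XB X0 i; have [K [_ HK]] := @poincare_sup R _ _ _ anch conn.
pose D k := Num.max (X k - B) 0.
have D0 j : D (rshift n j) = 0 by apply/max_idPr; rewrite subr_le0.
have DX k l : (D k - D l) ^+ 2 <= (D k - D l) * (X k - X l).
  by rewrite /D; case: (leP (X k - B) 0); case: (leP (X l - B) 0) => ? ?; nra.
pose e k l := c k l * ((D k - D l) * (X k - X l)).
have e_ge0 k l : 0 <= e k l.
  rewrite /e; have := cadj k l; case: ifP => _ Hc; last by rewrite (eqP Hc) mul0r.
  by apply: mulr_ge0; [exact: ltW | exact: le_trans (sqr_ge0 _) (DX k l)].
have := summation_by_parts X csym D0.
rewrite -/(\sum_k \sum_l e k l) big1 => [|a _]; last by rewrite X0 mulr0.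
rewrite mulr0 => /esym/eqP; rewrite oppr_eq0 psumr_eq0 => [|k _]; last first.
  by apply: sumr_ge0 => l _.
move=> /allP e0.
have De k l : adj k l -> `|D k - D l| <= 0.
  move=> akl; have := e0 k (mem_index_enum _); rewrite psumr_eq0//=.
  move=> /allP/(_ l (mem_index_enum _)); rewrite /e /=.
  have := cadj k l; rewrite akl => /lt0r_neq0/negPf ckl.
  rewrite mulf_eq0 ckl /= => /eqP DX0; rewrite normr_le0 -sqrf_eq0.
  by rewrite eq_le sqr_ge0 andbT -DX0 DX.
have := HK _ _ D0 De i; rewrite mulr0 normr_le0 => /eqP/max_idPr.
by rewrite subr_le0.
Qed.

Lemma opin_basis d (k : 'I_(n + m)) :
  opin d (fun=> 0) k =
  \sum_j d j * opin (fun a => (a == j)%:R) (fun=> 0) k :> R.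
Proof.
rewrite /opin; case: fintype.split => [i|j]; last first.
  by rewrite big1// => a _; rewrite mulr0.
rewrite (bigD1 i)//= eqxx mulr1 big1 ?addr0// => a /negPf ai.
by rewrite eq_sym ai mulr0.
Qed.

(** Linearity in coordinates, from which [lapZ], [lapB] and the matrix of [lap_surj] are read
    off. *)
Lemma lap_basis c d i :
  lap c (opin d (fun=> 0)) i =
  \sum_j d j * lap c (opin (fun a => (a == j)%:R) (fun=> 0)) i.
Proof.
rewrite /lap; under [RHS]eq_bigr do rewrite mulr_sumr.
rewrite exchange_big /=; apply: eq_bigr => l _.
rewrite !opin_basis mulrBr !mulr_sumr -sumrB; apply: eq_bigr => j _.
by ring.
Qed.

Lemma lapZ c d (t : R) i :
  lap c (opin (fun j => t * d j) (fun=> 0)) i = t * lap c (opin d (fun=> 0)) i.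
Proof.
rewrite lap_basis [in RHS]lap_basis mulr_sumr; apply: eq_bigr => j _.
by rewrite mulrA.
Qed.

Lemma lapB c u v i :
  lap c (opin (fun j => u j - v j) (fun=> 0)) i =
  lap c (opin u (fun=> 0)) i - lap c (opin v (fun=> 0)) i.
Proof.
rewrite lap_basis [in RHS]lap_basis [X in _ - X]lap_basis -sumrB.
by apply: eq_bigr => j _; rewrite mulrBl.
Qed.

Lemma lap_sym c u v :
  (forall k l, c k l = c l k) ->
  \sum_i u i * lap c (opin v (fun=> 0)) i =
  \sum_i v i * lap c (opin u (fun=> 0)) i.
Proof.
move=> csym.
have E w w' : 2 * (\sum_i w i * lap c (opin w' (fun=> 0)) i) =
  - \sum_k \sum_l c k l * ((opin w (fun=> 0) k - opin w (fun=> 0) l) *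
      (opin w' (fun=> 0) k - opin w' (fun=> 0) l)).
  rewrite -summation_by_parts//; last by move=> j; rewrite opin_rshift.
  by congr (2 * _); apply: eq_bigr => i _; rewrite opin_lshift.
apply: (@mulfI _ (2 : R)); first by rewrite pnatr_eq0.
rewrite !E; congr (- _); apply: eq_bigr => k _; apply: eq_bigr => l _.
by congr (_ * _); rewrite mulrC.
Qed.

(** The system is square, and [lap_estimate] with zero data gives a trivial kernel. *)
Lemma lap_surj (adj : rel 'I_(n + m)) (c0 : R) c r :
  anchored adj -> persuadable_connected adj -> 0 < c0 -> conductance adj c0 c ->
  exists p, forall i, lap c (opin p (fun=> 0)) i = r i.
Proof.
move=> anch conn c0_gt0 cc; have [K [_ HK]] := lap_estimate anch conn c0_gt0.
(* Vectors are rows, so row [j] of [S] is the image of the [j]-th basis vector. *)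
pose S := \matrix_(j < n, i < n) lap c (opin (fun a => (a == j)%:R) (fun=> 0)) i.
have SE (v : 'rV_n) i : (v *m S) ord0 i = lap c (opin (v ord0) (fun=> 0)) i.
  by rewrite lap_basis mxE; apply: eq_bigr => j _; rewrite mxE.
have Su : S \in unitmx.
  rewrite -row_free_unit -kermx_eq0; apply/rowV0P => v /sub_kermxP vS0.
  have := HK c (v ord0) cc; rewrite [X in _ <= _ * X]big1; last first.
    by move=> i _; rewrite -SE vS0 mxE expr0n.
  rewrite mulr0 => v0.
  have /eqP : \sum_i v ord0 i ^+ 2 = 0.
    by apply/le_anti; rewrite v0 sumr_ge0// => i _; exact: sqr_ge0.
  rewrite psumr_eq0 => [/allP v0'|i _]; last exact: sqr_ge0.
  apply/rowP => i; rewrite mxE; apply/eqP; rewrite -sqrf_eq0.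
  exact: v0' (mem_index_enum _).
exists (((\row_i r i) *m invmx S) ord0) => i.
by rewrite -SE mulmxKV// mxE.
Qed.

End LaplacianSystem.

(** * The logistic function and its divided differences *)

Section Sigmoid.
Variable R : realType.
Implicit Types a b t u v g del : R.

Definition sigm t := 1 / (1 + expR t).

(* Divided difference of expR at t and 0, extended by its limit 1 at t = 0. *)
Definition exp_slope t := if t == 0 then 1 else (expR t - 1) / t.

(** Divided difference of the logistic [sigm], factored so as to be defined and continuous across
    [a = b], where it equals the derivative. *)
Definition sigm_slope a b :=
  - (expR b * exp_slope (a - b) / ((1 + expR a) * (1 + expR b))).

Lemma exp_slopeE t : expR t - 1 = t * exp_slope t.
Proof.
rewrite /exp_slope; case: eqP => [->|/eqP t0]; first by rewrite expR0 subrr mul0r.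
by rewrite mulrC divfK.
Qed.

Lemma sigmB a b : sigm a - sigm b = sigm_slope a b * (a - b).
Proof.
have a0 : 1 + expR a != 0 by rewrite gt_eqF// addr_gt0// expR_gt0.
have b0 : 1 + expR b != 0 by rewrite gt_eqF// addr_gt0// expR_gt0.
have ab : expR b * (exp_slope (a - b) * (a - b)) = expR a - expR b.
  rewrite [X in _ * X]mulrC -exp_slopeE mulrBr mulr1 -expRD.
  by rewrite [b + _]addrC subrK.
have -> : sigm a - sigm b = - ((expR a - expR b) / ((1 + expR a) * (1 + expR b))).
  by rewrite /sigm; field; rewrite a0 b0.
by rewrite -ab /sigm_slope; ring.
Qed.

Lemma exp_slope_ge0 t : 0 <= exp_slope t.
Proof.
rewrite /exp_slope; case: eqP => // /eqP t0; case: (ltP t 0) => t_lt0.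
  apply: mulr_le0; last by rewrite invr_le0 ltW.
  by rewrite subr_le0 -expR0 ler_expR ltW.
by rewrite divr_ge0// subr_ge0 -expR0 ler_expR.
Qed.

Lemma exp_slope_le1 t : t <= 0 -> exp_slope t <= 1.
Proof.
rewrite le_eqVlt /exp_slope; case: eqP => //= /eqP t0 t_lt0.
by rewrite ler_ndivrMr// mul1r lerBrDl expR_ge1Dx.
Qed.

Lemma exp_slopeN t : exp_slope t = expR t * exp_slope (- t).
Proof.
rewrite /exp_slope oppr_eq0; case: eqP => [->|/eqP t0]; first by rewrite expR0 mulr1.
have e0 : expR t != 0 by rewrite gt_eqF// expR_gt0.
by rewrite expRN; field; rewrite t0 e0.
Qed.

Lemma sigm_slopeC a b : sigm_slope a b = sigm_slope b a.
Proof.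
rewrite /sigm_slope [exp_slope (a - b)]exp_slopeN opprB mulrA -expRD.
by rewrite [b + _]addrC subrK [X in _ / X]mulrC.
Qed.

(** By symmetry [a <= b]; then [exp_slope (a - b) <= 1], and [expR b] is below the denominator. *)
Lemma sigm_slope_bound a b : -1 <= sigm_slope a b <= 0.
Proof.
wlog ab : a b / a <= b => [H|].
  by case: (leP a b) => [/H//|/ltW/H]; rewrite sigm_slopeC.
have a0 := expR_gt0 a; have b0 := expR_gt0 b.
have s0 := exp_slope_ge0 (a - b).
have s1 : exp_slope (a - b) <= 1 by rewrite exp_slope_le1// subr_le0.
have d0 : 0 < (1 + expR a) * (1 + expR b) by rewrite mulr_gt0// addr_gt0.
rewrite /sigm_slope lerN2 oppr_le0 ler_pdivrMr// mul1r; apply/andP; split.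
  by nra.
by apply: divr_ge0; [apply: mulr_ge0 => //|]; exact: ltW.
Qed.

(** At 0 the limit is the derivative of [expR] there; elsewhere the quotient formula holds
    nearby. *)
Lemma continuous_exp_slope : continuous exp_slope.
Proof.
move=> t; have [->|t0] := eqVneq t 0.
  have /continuous_withinNx : exp_slope h @[h --> (0 : R)^'] --> exp_slope 0; last by [].
  have D := @ex_derive _ _ _ _ _ _ _ (is_derive_expR (0 : R)).
  have := @derive_val _ _ _ _ _ _ _ (is_derive_expR (0 : R)).
  move: D; rewrite /derive /derivable !expR0 => D limE.
  rewrite {2}/exp_slope eqxx -[X in _ --> X]limE; apply: cvg_trans D.
  apply: near_eq_cvg; near=> h.
  have /negPf h0 : h != 0 by near: h; exact: (@nbhs_dnbhs_neq R 0).
  by rewrite /exp_slope h0 /= /shift /= addr0 [h%:A]mulr1 [RHS]mulrC.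
pose q (s : R) : R := (expR s - 1) / s.
rewrite /continuous_at; have -> : exp_slope t = q t by rewrite /exp_slope (negPf t0).
have qt : (expR s - 1) / s @[s --> t] --> q t.
  apply: cvgM; last exact: cvgV.
  by apply: cvgB; [exact: continuous_expR|exact: cvg_cst].
apply: cvg_trans qt; apply: near_eq_cvg; near=> s.
have /negPf s0 : s != 0 by near: s; exact: (cvgr_neq0 t (@cvg_id _ _) t0).
by rewrite /exp_slope s0.
Unshelve. all: by end_near. Qed.

Variables (T : Type) (F : set_system T) (FF : Filter F).
Implicit Types f : T -> R.

Lemma cvg_sigm f a : f x @[x --> F] --> a -> sigm (f x) @[x --> F] --> sigm a.
Proof.
move=> fa; rewrite /sigm; apply: cvgM; first exact: cvg_cst.
apply: cvgV; first by rewrite gt_eqF// addr_gt0// expR_gt0.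
apply: cvgD; first exact: cvg_cst.
exact: (continuous_cvg FF (@continuous_expR R a)).
Qed.

Lemma cvg_sigm_slope f h a b :
  f x @[x --> F] --> a -> h x @[x --> F] --> b ->
  sigm_slope (f x) (h x) @[x --> F] --> sigm_slope a b.
Proof.
move=> fa hb; rewrite /sigm_slope; apply: cvgN.
have fe : expR (f x) @[x --> F] --> expR a.
  exact: (continuous_cvg FF (@continuous_expR R a)).
have he : expR (h x) @[x --> F] --> expR b.
  exact: (continuous_cvg FF (@continuous_expR R b)).
apply: cvgM.
  apply: cvgM => //.
  exact: (continuous_cvg FF (@continuous_exp_slope (a - b)) (cvgB fa hb)).
apply: cvgV; first by rewrite mulf_neq0// gt_eqF// addr_gt0// expR_gt0.
by apply: cvgM; apply: cvgD => //; exact: cvg_cst.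
Qed.

End Sigmoid.

(** * Secants of the SBCM numerator *)

(* Divided difference at u and v of phi(u) = u * sigm (g * u ^+ 2 - g * del). *)
Definition phi_secant (R : realType) (g del u v : R) : R :=
  sigm (g * u ^+ 2 - g * del) +
  g * v * (u + v) * sigm_slope (g * u ^+ 2 - g * del) (g * v ^+ 2 - g * del).

Section Secants.
Variable R : realType.
Implicit Types (g del u v M : R).

(** With [a] and [b] the two values of [sigm], write [u * a - v * b] as [(u - v) * a + v * (a - b)]
    and factor [u ^+ 2 - v ^+ 2] out of [a - b]. *)
Lemma phi_secantE g del u v :
  u * sigm (g * u ^+ 2 - g * del) - v * sigm (g * v ^+ 2 - g * del) =
  phi_secant g del u v * (u - v).
Proof.
have := sigmB (g * u ^+ 2 - g * del) (g * v ^+ 2 - g * del).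
rewrite /phi_secant; move: (sigm_slope _ _) (sigm _) (sigm _) => s b a ab.
have -> : b = a - s * (g * u ^+ 2 - g * del - (g * v ^+ 2 - g * del)).
  by lra.
ring.
Qed.

Lemma phi_secantN g del u v : phi_secant g del (- u) (- v) = phi_secant g del u v.
Proof. by rewrite /phi_secant !sqrrN; ring. Qed.

Lemma sigm_gt0 (t : R) : 0 < sigm t.
Proof. by rewrite divr_gt0// addr_gt0// expR_gt0. Qed.

Lemma sigm_lt1 (t : R) : sigm t < 1.
Proof. by rewrite ltr_pdivrMr ?addr_gt0 ?expR_gt0// mul1r ltrDl expR_gt0. Qed.

Lemma sigm_antitone (s t : R) : s <= t -> sigm t <= sigm s.
Proof.
move=> st; rewrite ler_wpM2l// lef_pV2 ?posrE ?addr_gt0 ?expR_gt0//.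
by rewrite lerD2l ler_expR.
Qed.

(** Here gamma must be small. The argument of the first [sigm] is at most 1, so that term lies
    between [sigm 1] and 1; the correction is at most [2 * (g * M ^+ 2)], hence at most half of
    [sigm 1]. *)
Lemma phi_secant_bounds g del u v M :
  0 <= g -> 0 <= del -> `|u| <= M -> `|v| <= M -> g * M ^+ 2 <= sigm 1 / 4 ->
  sigm 1 / 2 <= phi_secant g del u v <= 2.
Proof.
move=> g0 del0 uM vM gM.
have w0 := sigm_gt0 1; have w1 := sigm_lt1 1.
have gd : 0 <= g * del by rewrite mulr_ge0.
have u2 : g * u ^+ 2 <= g * M ^+ 2.
  rewrite ler_wpM2l// -real_normK ?num_real// ler_sqr ?nnegrE//.
  exact: le_trans uM.
have a1 : sigm 1 <= sigm (g * u ^+ 2 - g * del) by apply: sigm_antitone; lra.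
have := sigm_lt1 (g * u ^+ 2 - g * del).
have : `|g * v * (u + v) * sigm_slope (g * u ^+ 2 - g * del) (g * v ^+ 2 - g * del)|
    <= 2 * (g * M ^+ 2).
  have /andP[s1 s0] := sigm_slope_bound (g * u ^+ 2 - g * del) (g * v ^+ 2 - g * del).
  have M0 : 0 <= M by exact: le_trans uM.
  rewrite 3!normrM (ger0_norm g0) -!mulrA [leRHS]mulrCA ler_wpM2l//.
  have -> : 2 * M ^+ 2 = M * (M + M) * 1 by ring.
  rewrite mulrA; apply: ler_pM => //.
    by apply: ler_pM => //; apply: le_trans (ler_normD _ _) (lerD uM vM).
  by rewrite ler_norml; apply/andP; split; lra.
rewrite ler_norml /phi_secant => /andP[? ?] ?; apply/andP; split; lra.
Qed.

Lemma cvg_sigm_arg (T : Type) (F : set_system T) (FF : Filter F) del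
    (gs us : T -> R) (g u : R) :
  gs s @[s --> F] --> g -> us s @[s --> F] --> u ->
  gs s * us s ^+ 2 - gs s * del @[s --> F] --> g * u ^+ 2 - g * del.
Proof.
move=> gsg usu; apply: cvgB; last by apply: cvgM => //; exact: cvg_cst.
by apply: cvgM => //; rewrite expr2; apply: cvgM.
Qed.

Lemma cvg_phi_secant (T : Type) (F : set_system T) (FF : Filter F) del
    (gs us vs : T -> R) (g u v : R) :
  gs s @[s --> F] --> g -> us s @[s --> F] --> u -> vs s @[s --> F] --> v ->
  phi_secant (gs s) del (us s) (vs s) @[s --> F] --> phi_secant g del u v.
Proof.
move=> gsg usu vsv; apply: cvgD; first by apply: cvg_sigm; exact: cvg_sigm_arg.
apply: cvgM; last by apply: cvg_sigm_slope; exact: cvg_sigm_arg.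
by apply: cvgM; [apply: cvgM | apply: cvgD].
Qed.

End Secants.

Lemma cvg_lap (R : realType) (n m : nat) (T : Type) (F : set_system T)
    (FF : Filter F) (cs : T -> 'I_(n + m) -> 'I_(n + m) -> R) c
    (Xs : T -> 'I_(n + m) -> R) X (i : 'I_n) :
  (forall k l, cs s k l @[s --> F] --> c k l) ->
  (forall k, Xs s k @[s --> F] --> X k) ->
  lap (cs s) (Xs s) i @[s --> F] --> lap c X i.
Proof.
move=> csc XsX; apply: cvg_big => [|l _]; first exact: add_continuous.
by apply: cvgM => //; apply: cvgB.
Qed.

(** * The numerator of the SBCM as a force, and its divided differences *)

Definition force (R : realType) (n m : nat) (adj : rel 'I_(n + m)) (g del : R)
    (X : 'I_(n + m) -> R) : 'I_n -> R :=
  lap (fun k l => infl adj g del k l (X k) (X l)) X.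

(** Edge weights that make the difference of two forces an exact linear Laplacian; [X = Y] is
    allowed and gives the linearisation. *)
Definition secant (R : realType) (n m : nat) (adj : rel 'I_(n + m)) (g del : R)
    (X Y : 'I_(n + m) -> R) (k l : 'I_(n + m)) : R :=
  if adj k l then phi_secant g del (X k - X l) (Y k - Y l) else 0.

(* Divided difference of [force] in the parameter, at [g'] and [g]. *)
Definition drift (R : realType) (n m : nat) (adj : rel 'I_(n + m)) (g' g del : R)
    (X : 'I_(n + m) -> R) : 'I_n -> R :=
  lap (fun k l => if adj k l then
         sigm_slope (g' * (X k - X l) ^+ 2 - g' * del)
                    (g * (X k - X l) ^+ 2 - g * del) * ((X k - X l) ^+ 2 - del)
       else 0) X.

Section Force.
Variables (R : realType) (n m : nat) (adj : rel 'I_(n + m)).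
Hypothesis adjC : forall k l, adj k l = adj l k.
Implicit Types (X Y : 'I_(n + m) -> R) (g del : R).

Lemma inflE g del k l a b :
  infl adj g del k l a b =
  if adj k l then sigm (g * (a - b) ^+ 2 - g * del) else 0.
Proof. by []. Qed.

Lemma force_secant g del X Y i :
  force adj g del X i - force adj g del Y i =
  lap (secant adj g del X Y) (fun k => X k - Y k) i.
Proof.
rewrite -sumrB; apply: eq_bigr => l _; rewrite !inflE /secant.
case: ifP => _; last by rewrite !mul0r subrr.
have := phi_secantE g del (X (lshift m i) - X l) (Y (lshift m i) - Y l); lra.
Qed.

Lemma force_drift g' g del X i :
  force adj g' del X i - force adj g del X i = (g' - g) * drift adj g' g del X i.
Proof.
rewrite -sumrB mulr_sumr; apply: eq_bigr => l _; rewrite !inflE.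
case: ifP => _; last by rewrite !mul0r mulr0 subrr.
set u := X (lshift m i) - X l.
by rewrite -mulrBl sigmB; ring.
Qed.

(** Opinions bounded by [B] differ by at most [B + B], whence the form of the smallness condition.
    Symmetry comes from the oddness of phi. *)
Lemma secant_conductance g del B X Y :
  0 <= g -> 0 <= del -> g * (B + B) ^+ 2 <= sigm 1 / 4 ->
  (forall k, `|X k| <= B) -> (forall k, `|Y k| <= B) ->
  conductance adj (sigm 1 / 2) (secant adj g del X Y).
Proof.
move=> g0 del0 gB XB YB; split=> k l; rewrite /secant.
  rewrite adjC; case: ifP => // _.
  by rewrite -phi_secantN !opprB.
case: (adj k l) => //.
have H (Z : 'I_(n + m) -> R) : (forall k, `|Z k| <= B) -> `|Z k - Z l| <= B + B.
  by move=> ZB; apply: le_trans (ler_normB _ _) (lerD _ _).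
by have /andP[] := phi_secant_bounds g0 del0 (H _ XB) (H _ YB) gB.
Qed.

Lemma secant_le2 g del B X Y k l :
  0 <= g -> 0 <= del -> g * (B + B) ^+ 2 <= sigm 1 / 4 ->
  (forall k, `|X k| <= B) -> (forall k, `|Y k| <= B) ->
  `|secant adj g del X Y k l| <= 2.
Proof.
move=> g0 del0 gB XB YB; rewrite /secant; case: ifP => _; last by rewrite normr0.
have H (Z : 'I_(n + m) -> R) : (forall k, `|Z k| <= B) -> `|Z k - Z l| <= B + B.
  by move=> ZB; apply: le_trans (ler_normB _ _) (lerD _ _).
have /andP[s0 s2] := phi_secant_bounds g0 del0 (H _ XB) (H _ YB) gB.
rewrite ger0_norm//; apply: le_trans s0; apply: divr_ge0 => //.
exact/ltW/sigm_gt0.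
Qed.

Section Limits.
Variables (T : Type) (F : set_system T) (FF : Filter F).
Variables (gs : T -> R) (Xs Ys : T -> 'I_(n + m) -> R) (g del : R).
Variables (X Y : 'I_(n + m) -> R).
Hypothesis gsg : gs s @[s --> F] --> g.
Hypothesis XsX : forall k, Xs s k @[s --> F] --> X k.
Hypothesis YsY : forall k, Ys s k @[s --> F] --> Y k.

Lemma cvg_secant k l :
  secant adj (gs s) del (Xs s) (Ys s) k l @[s --> F] --> secant adj g del X Y k l.
Proof.
rewrite /secant; case: ifP => _; last exact: cvg_cst.
by apply: cvg_phi_secant => //; apply: cvgB.
Qed.

Lemma cvg_infl k l :
  infl adj (gs s) del k l (Xs s k) (Xs s l) @[s --> F] -->
  infl adj g del k l (X k) (X l).
Proof.
under eq_fun do rewrite inflE; rewrite inflE; case: ifP => _; last exact: cvg_cst.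
by apply: cvg_sigm; apply: cvg_sigm_arg => //; apply: cvgB.
Qed.

Lemma cvg_force i : force adj (gs s) del (Xs s) i @[s --> F] --> force adj g del X i.
Proof. by apply: cvg_lap => // k l; exact: cvg_infl. Qed.

End Limits.

Lemma cvg_drift (T : Type) (F : set_system T) (FF : Filter F)
    (gs hs : T -> R) (Xs : T -> 'I_(n + m) -> R) g h del X i :
  gs s @[s --> F] --> g -> hs s @[s --> F] --> h ->
  (forall k, Xs s k @[s --> F] --> X k) ->
  drift adj (gs s) (hs s) del (Xs s) i @[s --> F] --> drift adj g h del X i.
Proof.
move=> gsg hsh XsX; apply: cvg_lap => // k l; case: ifP => _; last exact: cvg_cst.
have u : Xs s k - Xs s l @[s --> F] --> X k - X l by apply: cvgB.
apply: cvgM; first by apply: cvg_sigm_slope; exact: cvg_sigm_arg.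
by apply: cvgB; [rewrite expr2; apply: cvgM | exact: cvg_cst].
Qed.

Lemma adj_exists : anchored adj -> persuadable_connected adj ->
  forall i, exists l, adj (lshift m i) l.
Proof.
move=> [i0 [j0 a0]] [_ conn] i.
have /connectP[[|a p] /= pp lp] := conn i i0.
  by exists (rshift n j0); rewrite -lp.
by exists (lshift m a); case/andP: pp.
Qed.

(** Every persuadable node has a neighbour. Positivity matters because a quotient with zero
    denominator is 0 by convention and would pass for a steady state. *)
Lemma weight_gt0 g del X : anchored adj -> persuadable_connected adj ->
  forall i, 0 < \sum_l infl adj g del (lshift m i) l (X (lshift m i)) (X l).
Proof.
move=> anch conn i; have [l0 a0] := adj_exists anch conn i.
rewrite (bigD1 l0)//= ltr_wpDr//; last by rewrite inflE a0 sigm_gt0.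
by apply: sumr_ge0 => l _; rewrite inflE; case: ifP => // _; exact/ltW/sigm_gt0.
Qed.

Lemma sbcm_fE g del z x i :
  sbcm_f adj g del z x i = force adj g del (opin x z) i /
    \sum_l infl adj g del (lshift m i) l (opin x z (lshift m i)) (opin x z l).
Proof. by []. Qed.

Lemma steady_stateP g del z x : anchored adj -> persuadable_connected adj ->
  steady_state adj g del z x <-> forall i, force adj g del (opin x z) i = 0.
Proof.
move=> anch conn.
have W0 i := lt0r_neq0 (weight_gt0 g del (opin x z) anch conn i).
split=> H i; last by rewrite sbcm_fE H mul0r.
by have /eqP := H i; rewrite sbcm_fE mulf_eq0 invr_eq0 (negPf (W0 i)) orbF => /eqP.
Qed.

(** If no persuadable node were adjacent to a zealot, adding 1 to all persuadable opinions would
    give a second steady state, a different one as [n > 0]. *)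
Lemma steady_unique_anchored g del z xbar :
  (0 < n)%N -> steady_state adj g del z xbar ->
  (forall y : 'I_n -> R, steady_state adj g del z y -> y = xbar) -> anchored adj.
Proof.
move=> n0 st uniq; apply: contrapT => nanch.
have nadj i j : adj (lshift m i) (rshift n j) = false.
  by apply/negP => a; apply: nanch; exists i, j.
have shift1 (a b : R) : a + 1 - (b + 1) = a - b by ring.
have : (fun i => xbar i + 1) = xbar.
  apply: uniq => i; rewrite -(st i) /sbcm_f; congr (_ / _).
    rewrite !big_split_ord /=; congr (_ + _); apply: eq_bigr => l _.
      by rewrite !opin_lshift !inflE !shift1.
    by rewrite !inflE !nadj !mul0r.
  rewrite !big_split_ord /=; congr (_ + _); apply: eq_bigr => l _.
    by rewrite !opin_lshift !inflE !shift1.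
  by rewrite !inflE !nadj.
move=> /(congr1 (fun f => f (Ordinal n0))) /eqP.
by rewrite -subr_eq0 addrAC subrr add0r oner_eq0.
Qed.

End Force.

(** * Existence and uniqueness of steady states *)

Lemma cvg_sum_sqr (R : realType) (T : Type) (F : set_system T) (FF : Filter F)
    (n : nat) (fs : T -> 'I_n -> R) (f : 'I_n -> R) :
  (forall i, fs s i @[s --> F] --> f i) ->
  \sum_i fs s i ^+ 2 @[s --> F] --> \sum_i f i ^+ 2.
Proof.
move=> fsf; apply: cvg_big => [|i _]; first exact: add_continuous.
by rewrite expr2; apply: cvgM.
Qed.

(** A sum rather than a maximum: it bounds every [z j] in absolute value and makes sense for [m = 0]
    too. *)
Definition zealot_bound (R : realType) (m : nat) (z : 'I_m -> R) : R :=
  \sum_j `|z j|.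

Section SteadyStates.
Variables (R : realType) (n m : nat) (adj : rel 'I_(n + m)).
Hypothesis adjC : forall k l, adj k l = adj l k.
Hypothesis anch : anchored adj.
Hypothesis conn : persuadable_connected adj.
Variables (z : 'I_m -> R) (del : R).
Hypothesis del0 : 0 <= del.

Let B := zealot_bound z.

Let B_ge0 : 0 <= B. Proof. exact: sumr_ge0. Qed.

Let zB j : `|z j| <= B.
Proof. by rewrite /B /zealot_bound (bigD1 j)//= lerDl sumr_ge0. Qed.

Lemma opin_norm_le (x : 'I_n -> R) :
  (forall i, `|x i| <= B) -> forall k, `|opin x z k| <= B.
Proof. by move=> xB k; rewrite /opin; case: fintype.split. Qed.

(** A steady state is harmonic for its own positive weights; the maximum principle is applied to it
    and to its negative. *)
Lemma steady_bounded g x : steady_state adj g del z x ->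
  forall k, `|opin x z k| <= B.
Proof.
move=> /(steady_stateP _ _ _ _ anch conn) st; apply: opin_norm_le => i.
pose c k l := infl adj g del k l (opin x z k) (opin x z l).
have csym k l : c k l = c l k.
  rewrite /c !inflE adjC; case: (adj l k) => //.
  by rewrite -(sqrrN (_ - _)) opprB.
have cadj k l : if adj k l then 0 < c k l else c k l == 0.
  by rewrite /c inflE; case: (adj k l); [exact: sigm_gt0 | exact: eqxx].
rewrite ler_norml; apply/andP; split.
  rewrite lerNl -(opin_lshift x z i).
  apply: (lap_max_principle (X := fun k => - opin x z k) anch conn csym cadj).
    by move=> j; rewrite opin_rshift; apply: le_trans (zB j); rewrite -normrN ler_norm.
  move=> a; transitivity (- force adj g del (opin x z) a); last by rewrite st oppr0.
  by rewrite -sumrN; apply: eq_bigr => l _; rewrite -mulrN opprD.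
rewrite -(opin_lshift x z i).
apply: (lap_max_principle anch conn csym cadj) => [j|]; last exact: st.
by rewrite opin_rshift; apply: le_trans (zB j); rewrite ler_norm.
Qed.

Lemma force_opinB g (x y : 'I_n -> R) i :
  force adj g del (opin x z) i - force adj g del (opin y z) i =
  lap (secant adj g del (opin x z) (opin y z))
      (opin (fun a => x a - y a) (fun=> 0)) i.
Proof.
by rewrite force_secant; congr lap; apply/funext => k; rewrite opinB.
Qed.

Section SmallParameter.
Variable g : R.
Hypothesis g0 : 0 <= g.
Hypothesis gB : g * (B + B) ^+ 2 <= sigm 1 / 4.

Lemma steady_unique x y :
  steady_state adj g del z x -> steady_state adj g del z y -> x = y.
Proof.
move=> stx sty.
have cc := secant_conductance adjC g0 del0 gB (steady_bounded stx) (steady_bounded sty).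
have c0 : 0 < sigm 1 / 2 :> R by rewrite divr_gt0// sigm_gt0.
have [K [_ HK]] := lap_estimate anch conn c0.
have := HK _ (fun a => x a - y a) cc; rewrite [X in _ <= _ * X]big1; last first.
  move=> i _; rewrite -force_opinB.
  move/(steady_stateP _ _ _ _ anch conn): stx => ->.
  by move/(steady_stateP _ _ _ _ anch conn): sty => ->; rewrite subrr expr0n.
rewrite mulr0 => le0; apply/funext => i; apply/eqP; rewrite -subr_eq0 -sqrf_eq0.
rewrite eq_le sqr_ge0 andbT; apply: le_trans le0.
by rewrite (bigD1 i)//= lerDl sumr_ge0// => j _; exact: sqr_ge0.
Qed.

(** Crude count: each of the [n] rows has [n + m] terms, each at most 4 times the Euclidean norm of
    [d]. *)
Lemma lap_sqr_le (c : 'I_(n + m) -> 'I_(n + m) -> R) (d : 'I_n -> R) :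
  (forall k l, `|c k l| <= 2) ->
  \sum_i lap c (opin d (fun=> 0)) i ^+ 2 <=
  n%:R * (16 * (n + m)%:R ^+ 2) * \sum_i d i ^+ 2.
Proof.
move=> c2; set P := \sum_i d i ^+ 2.
have P0 : 0 <= P by apply: sumr_ge0 => i _; exact: sqr_ge0.
have dP k : `|opin d (fun=> 0) k| <= Num.sqrt P.
  rewrite /opin; case: fintype.split => [i|j]; last by rewrite normr0 sqrtr_ge0.
  rewrite -sqrtr_sqr ler_wsqrtr// /P (bigD1 i)//= lerDl.
  by apply: sumr_ge0 => j _; exact: sqr_ge0.
rewrite -mulrA mulr_natl -[n in _ *+ n]card_ord -sumr_const.
apply: ler_sum => i _.
have -> : 16 * (n + m)%:R ^+ 2 * P = ((n + m)%:R * (4 * Num.sqrt P)) ^+ 2.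
  by rewrite !exprMn sqr_sqrtr//; ring.
rewrite -[leLHS]real_normK ?num_real// ler_sqr ?nnegrE ?mulr_ge0 ?sqrtr_ge0//.
apply: le_trans (ler_norm_sum _ _ _) _.
rewrite mulr_natl -[X in _ *+ X]card_ord -sumr_const; apply: ler_sum => l _.
rewrite normrM; have -> : 4 * Num.sqrt P = 2 * (Num.sqrt P + Num.sqrt P) by ring.
by apply: ler_pM => //; apply: le_trans (ler_normB _ _) (lerD _ _).
Qed.

(* [y] is an explicit Euler step from [x]; hence a minimiser of the sum of squared
   forces over the box is a steady state. *)
Lemma euler_step : exists tau : R, forall x : 'I_n -> R,
  let N := force adj g del (opin x z) in
  let y i := x i + tau * N i in
  (forall i, `|x i| <= B) -> (forall i, `|y i| <= B) /\
  (\sum_i N i ^+ 2 <= \sum_i force adj g del (opin y z) i ^+ 2 ->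
   steady_state adj g del z x).
Proof.
have c0 : 0 < sigm 1 / 2 :> R by rewrite divr_gt0// sigm_gt0.
have [K [K0 HK]] := @energy_coercive R _ _ _ anch conn.
(* [L] is the constant of [lap_sqr_le]; [q] is an inverse coercivity constant, giving
   [P <= - (q * E)] below. *)
pose L : R := n%:R * (16 * (n + m)%:R ^+ 2).
pose q := K / (sigm 1 / 2).
have q0 : 0 < q by rewrite divr_gt0.
have L0 : 0 <= L by rewrite !mulr_ge0// sqr_ge0.
have nm0 : 0 <= (n + m)%:R :> R by [].
have Lq0 : 0 <= L * q by apply: mulr_ge0 => //; exact: ltW.
have D0 : 0 < 1 + (n + m)%:R + L * q by lra.
(* Small enough for two purposes: [tau * (n + m)%:R <= 1] keeps the step in the box, and
   [tau * L * q <= 1] lets the linear decrease beat the quadratic term. *)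
pose tau := (1 + (n + m)%:R + L * q)^-1.
have tau0 : 0 < tau by rewrite invr_gt0.
have tauE : tau + tau * (n + m)%:R + tau * L * q = 1.
  rewrite -mulrA -[X in X + _ + _]mulr1 -!mulrDr mulVf//.
  exact: lt0r_neq0.
have taunm : tau * (n + m)%:R <= 1.
  have : 0 <= tau * (L * q) by exact: mulr_ge0 (ltW tau0) Lq0.
  by lra.
have tauL : tau * L * q <= 1.
  have : 0 <= tau * (n + m)%:R by exact: mulr_ge0 (ltW tau0) nm0.
  by lra.
exists tau => x N y xB.
have XB := opin_norm_le xB.
pose w i l := infl adj g del (lshift m i) l (opin x z (lshift m i)) (opin x z l).
have w01 i l : 0 <= w i l <= 1.
  rewrite /w inflE; case: ifP => _; last by rewrite lexx ler01.
  by rewrite !ltW ?sigm_gt0 ?sigm_lt1.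
have wsum i : 0 <= 1 - tau * \sum_l w i l.
  rewrite subr_ge0; apply: le_trans taunm; apply: ler_wpM2l; first exact: ltW.
  have -> : (n + m)%:R = \sum_(l < n + m) 1 :> R by rewrite sumr_const card_ord.
  apply: ler_sum => l _.
  by have /andP[] := w01 i l.
have NE i : tau * N i = tau * (\sum_l w i l * opin x z l) - tau * (\sum_l w i l) * x i.
  transitivity (tau * \sum_l (w i l * opin x z l - w i l * x i)).
    by congr (_ * _); apply: eq_bigr => l _; rewrite -mulrBr -(opin_lshift x z i).
  by rewrite sumrB -mulr_suml mulrBr mulrA.
(* [y i] is an average of [x i] and the opinions [opin x z l], with nonnegative weights of sum 1. *)
have yB i : `|y i| <= B.
  have -> : y i = (1 - tau * \sum_l w i l) * x i + tau * (\sum_l w i l * opin x z l).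
    by rewrite /y NE; ring.
  apply: le_trans (ler_normD _ _) _.
  have -> : B = (1 - tau * \sum_l w i l) * B + tau * (\sum_l w i l * B).
    by rewrite -mulr_suml; ring.
  apply: lerD; first by rewrite normrM ger0_norm// ler_wpM2l.
  rewrite normrM gtr0_norm//; apply: ler_wpM2l; first exact: ltW.
  apply: le_trans (ler_norm_sum _ _ _) _; apply: ler_sum => l _.
  by have /andP[w0 _] := w01 i l; rewrite normrM ger0_norm// ler_wpM2l.
split=> //; have YB := opin_norm_le yB.
pose c := secant adj g del (opin y z) (opin x z).
have cc : conductance adj (sigm 1 / 2) c by exact: secant_conductance gB YB XB.
have yE i : force adj g del (opin y z) i = N i + tau * lap c (opin N (fun=> 0)) i.
  have := force_opinB g y x i; rewrite -/c -/(N i).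
  have -> : (fun a => y a - x a) = (fun a => tau * N a).
    by apply/funext => a; rewrite /y addrC addKr.
  by rewrite lapZ; lra.
have c2 k l : `|c k l| <= 2 by exact: secant_le2 gB YB XB.
have := lap_sqr_le N c2; have := HK _ _ N c0 cc.
set E := \sum_i N i * _; set S := \sum_i lap _ _ i ^+ 2; set P := \sum_i N i ^+ 2.
rewrite -/L => HE HS.
have -> : \sum_i force adj g del (opin y z) i ^+ 2 = P + 2 * tau * E + tau ^+ 2 * S.
  rewrite /P /E /S !mulr_sumr -!big_split /=; apply: eq_bigr => i _.
  by rewrite yE; ring.
move=> PP; apply/(steady_stateP _ _ _ _ anch conn) => i; apply/eqP.
have P0 : 0 <= P by apply: sumr_ge0 => a _; exact: sqr_ge0.
(* If the step does not lower the sum, then [0 <= 2 * E + tau * S]; after multiplication by [q] the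
   two terms are at most [- (2 * P)] and [P]. *)
have P_le0 : P <= 0.
  have E1 : P <= - (q * E).
    by rewrite -mulNr /q -mulNr mulrAC ler_pdivlMr// mulrC mulNr.
  have h1 : 0 <= 2 * E + tau * S by nra.
  have h2 : tau * S <= tau * (L * P) by apply: ler_wpM2l => //; exact: ltW.
  have h3 : q * (tau * (L * P)) <= P.
    have -> : q * (tau * (L * P)) = tau * L * q * P by ring.
    by rewrite ler_piMl.
  nra.
rewrite -sqrf_eq0 eq_le sqr_ge0 andbT; apply: le_trans P_le0.
by rewrite /P (bigD1 i)//= lerDl sumr_ge0// => j _; exact: sqr_ge0.
Qed.

(** The sum of squared forces has a minimiser over the compact box; its Euler step stays in the box
    and cannot lower the sum. *)
Lemma steady_exists : exists x, steady_state adj g del z x.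
Proof.
have [tau Htau] := euler_step.
pose f (v : 'rV[R]_n) := \sum_i force adj g del (opin (v ord0) z) i ^+ 2.
pose A := [set v : 'rV[R]_n | forall i, `[- B, B]%classic (v ord0 i)].
have Ac : compact A.
  exact: (@rV_compact R n (fun=> `[- B, B]%classic) (fun=> @segment_compact R _ _)).
have A0 : A !=set0.
  by exists 0 => i; rewrite /= mxE in_itv /= oppr_le0 B_ge0.
have fc : continuous f.
  move=> v; suff : f w @[w --> v] --> f v by [].
  apply: (cvg_sum_sqr (nbhs_filter v)) => i.
  have fv : force adj g del (opin (w ord0) z) i @[w --> v] -->
            force adj g del (opin (v ord0) z) i.
    apply: (cvg_force (nbhs_filter v)) => [|k]; first exact: cvg_cst.
    rewrite /opin; case: fintype.split => j; last exact: cvg_cst.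
    exact: coord_continuous.
  exact: fv.
have [v /set_mem vA vmin] := EVT_min_rV A0 Ac (continuous_subspaceT fc).
have vB i : `|v ord0 i| <= B by have := vA i; rewrite /= in_itv /= ler_norml.
exists (v ord0); have [yB] := Htau (v ord0) vB.
apply; pose y := \row_i (v ord0 i + tau * force adj g del (opin (v ord0) z) i).
have := vmin y; rewrite /f.
have -> : y ord0 = fun i => v ord0 i + tau * force adj g del (opin (v ord0) z) i.
  by apply/funext => i; rewrite mxE.
apply; apply/mem_set => i; rewrite /= in_itv /= -ler_norml mxE.
exact: yB.
Qed.

End SmallParameter.

End SteadyStates.

(** * Stability and smoothness of the branch *)

Section Convergence.
Variables (R : realType) (n m : nat) (adj : rel 'I_(n + m)).
Hypothesis anch : anchored adj.
Hypothesis conn : persuadable_connected adj.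
Variables (T : Type) (F : set_system T) (FF : Filter F).

(** The constant of [lap_estimate] depends only on the graph and [c0], so it is uniform along [F]
    and squeezes the squares to 0. *)
Lemma lap_solution_cvg0 (c0 : R) (cs : T -> 'I_(n + m) -> 'I_(n + m) -> R)
    (ds rs : T -> 'I_n -> R) :
  0 < c0 ->
  (\forall s \near F, conductance adj c0 (cs s) /\
     forall i, lap (cs s) (opin (ds s) (fun=> 0)) i = rs s i) ->
  (forall i, rs s i @[s --> F] --> 0) -> forall i, ds s i @[s --> F] --> 0.
Proof.
move=> c0_gt0 sol rs0 i; have [K [_ HK]] := lap_estimate anch conn c0_gt0.
have upper : K * \sum_i rs s i ^+ 2 @[s --> F] --> 0.
  have E0 : K * \sum_(a < n) (0 : R) ^+ 2 = 0.
    by rewrite big1 ?mulr0// => a _; rewrite expr0n.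
  suff : K * \sum_i rs s i ^+ 2 @[s --> F] --> K * \sum_(a < n) (0 : R) ^+ 2.
    by rewrite E0.
  apply: cvgM; first exact: cvg_cst.
  exact: (cvg_sum_sqr FF (f := fun=> 0)).
have d2 : ds s i ^+ 2 @[s --> F] --> 0.
  apply: squeeze_cvgr (cvg_cst 0) upper; near=> s.
  have [cc lapE] : conductance adj c0 (cs s) /\
     forall i, lap (cs s) (opin (ds s) (fun=> 0)) i = rs s i by near: s.
  rewrite sqr_ge0 /=; have := HK _ (ds s) cc.
  under [X in _ <= _ * X]eq_bigr do rewrite lapE.
  apply: le_trans; rewrite (bigD1 i)//= lerDl.
  by apply: sumr_ge0 => j _; exact: sqr_ge0.
apply: norm_cvg0.
have -> : (fun s => `|ds s i|) = Num.sqrt \o (fun s => ds s i ^+ 2).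
  by apply/funext => s /=; rewrite sqrtr_sqr.
rewrite -[X in _ --> X](@sqrtr0 R).
exact: (continuous_cvg FF (@sqrt_continuous R 0)).
Unshelve. all: by end_near. Qed.

(** The error [ps s - p] solves the system at [s] with data [es], the residual of [p], which tends
    to 0. *)
Lemma lap_solution_cvg (c0 : R) (cs : T -> 'I_(n + m) -> 'I_(n + m) -> R)
    (ps rs : T -> 'I_n -> R) (c : 'I_(n + m) -> 'I_(n + m) -> R) (p r : 'I_n -> R) :
  0 < c0 ->
  (\forall s \near F, conductance adj c0 (cs s) /\
     forall i, lap (cs s) (opin (ps s) (fun=> 0)) i = rs s i) ->
  (forall k l, cs s k l @[s --> F] --> c k l) ->
  (forall i, rs s i @[s --> F] --> r i) ->
  (forall i, lap c (opin p (fun=> 0)) i = r i) ->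
  forall i, ps s i @[s --> F] --> p i.
Proof.
move=> c0_gt0 sol csc rsr pr i.
suff ps0 : ps s i - p i @[s --> F] --> 0 by exact: (cvg_sub0 ps0 (cvg_cst (p i))).
pose es s j := rs s j - lap (cs s) (opin p (fun=> 0)) j.
apply: (lap_solution_cvg0 (ds := fun s j => ps s j - p j) (rs := es) (cs := cs) c0_gt0).
  apply: filterS sol => s [cc lapE]; split=> // j.
  by rewrite lapB lapE.
move=> j; rewrite -(subrr (r j)) -{2}pr; apply: cvgB => //.
by apply: cvg_lap => // k; exact: cvg_cst.
Qed.

End Convergence.

(** * The Jacobian at a steady state *)

Section Stability.
Variables (R : realType) (n m : nat) (adj : rel 'I_(n + m)).
Hypothesis adjC : forall k l, adj k l = adj l k.
Hypothesis anch : anchored adj.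
Hypothesis conn : persuadable_connected adj.
Variables (z : 'I_m -> R) (del g : R) (x : 'I_n -> R).
Hypothesis st : steady_state adj g del z x.

Let X := opin x z.
Let c := secant adj g del X X.
Let W i := \sum_l infl adj g del (lshift m i) l (X (lshift m i)) (X l).

(** As the force vanishes at [x], the derivative of the denominator contributes nothing. Each
    difference quotient is exactly a secant Laplacian over the perturbed denominator, and both
    converge. *)
Lemma jacobianP_steady i j :
  jacobianP adj g del z x i j =
  lap c (opin (fun a => (a == j)%:R) (fun=> 0)) i / W i.
Proof.
pose xt (t : R) k := if k == j then x k + t else x k.
pose e : 'I_n -> R := fun a => (a == j)%:R.
rewrite mxE /partial /derive1.
have xt0 : xt 0 = x by apply/funext => k; rewrite /xt addr0 if_same.
have stF := (steady_stateP g del z x anch conn).1 st.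
have F0 : sbcm_f adj g del z (xt 0) i = 0 by rewrite xt0 st.
have X0 k : opin (xt t) z k @[t --> (0 : R)^'] --> X k.
  rewrite /X /opin; case: fintype.split => [a|b]; last exact: cvg_cst.
  rewrite /xt; case: (a == j); last exact: cvg_cst.
  rewrite -[Y in _ --> Y]addr0; apply: cvgD; first exact: cvg_cst.
  exact: (@nbhs_dnbhs R 0).
have slope t : t != 0 -> lap (secant adj g del (opin (xt t) z) X) (opin e (fun=> 0)) i /
    \sum_l infl adj g del (lshift m i) l (opin (xt t) z (lshift m i)) (opin (xt t) z l)
  = t^-1 *: (sbcm_f adj g del z (xt (t + 0)) i - sbcm_f adj g del z (xt 0) i).
  move=> t0; rewrite F0 subr0 addr0 sbcm_fE.
  have := force_opinB adj z del g (xt t) x i.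
  rewrite (stF i) subr0 => ->.
  have -> : (fun a => xt t a - x a) = (fun a => t * e a).
    apply/funext => a; rewrite /xt /e; case: ifP => _.
      by rewrite addrAC subrr add0r mulr1.
    by rewrite subrr mulr0.
  rewrite lapZ -[RHS]/(t^-1 * _) mulrA mulKf//.
have lim_slope : lap (secant adj g del (opin (xt t) z) X) (opin e (fun=> 0)) i /
    \sum_l infl adj g del (lshift m i) l (opin (xt t) z (lshift m i)) (opin (xt t) z l)
    @[t --> (0 : R)^'] --> lap c (opin e (fun=> 0)) i / W i.
  apply: cvgM.
    apply: cvg_lap => [k l|k]; last exact: cvg_cst.
    by apply: cvg_secant => // [|k']; exact: cvg_cst.
  apply: cvgV; first by rewrite gt_eqF// (weight_gt0 g del X anch conn).
  apply: cvg_big => [|l _]; first exact: add_continuous.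
  have Hl := @cvg_infl R n m adj R _ (dnbhs_filter (0 : R)) (fun=> g)
    (fun t => opin (xt t) z) g del X (cvg_cst g) X0 (lshift m i) l.
  exact: Hl.
apply: cvg_lim; first exact: norm_hausdorff.
apply: cvg_trans lim_slope; apply: near_eq_cvg; near=> t.
by apply: slope; near: t; exact: (@nbhs_dnbhs_neq R 0).
Unshelve. all: by end_near. Qed.

End Stability.

(** * Negativity of the eigenvalues *)

Section LinearStability.
Variables (R : realType) (n m : nat) (adj : rel 'I_(n + m)).
Hypothesis anch : anchored adj.
Hypothesis conn : persuadable_connected adj.

(* If p + iq is an eigenvector of the weighted Laplacian for the eigenvalue
   a + ib, symmetry forces b = 0 and coercivity forces a < 0. *)
Lemma lap_pencil_eigenvalue (c0 : R) c (W p q : 'I_n -> R) (a b : R) :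
  0 < c0 -> conductance adj c0 c ->
  (forall i, lap c (opin p (fun=> 0)) i = W i * (a * p i - b * q i)) ->
  (forall i, lap c (opin q (fun=> 0)) i = W i * (a * q i + b * p i)) ->
  (exists i, (p i != 0) || (q i != 0)) -> (forall i, 0 < W i) ->
  b = 0 /\ a < 0.
Proof.
move=> c0_gt0 cc lp lq [i0 pq0] W0; have [csym _] := cc.
pose S := \sum_i W i * (p i ^+ 2 + q i ^+ 2).
have S0 : 0 < S.
  have t0 i : 0 <= W i * (p i ^+ 2 + q i ^+ 2).
    by apply: mulr_ge0; [exact: ltW | rewrite addr_ge0// sqr_ge0].
  rewrite /S (bigD1 i0)//= ltr_pwDl ?sumr_ge0// mulr_gt0//.
  rewrite lt_neqAle addr_ge0 ?sqr_ge0// andbT eq_sym paddr_eq0 ?sqr_ge0//.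
  by rewrite !sqrf_eq0 negb_and.
split.
  (* The two pairings of [p] and [q] agree by symmetry, while their difference is [b * S]. *)
  have bS : b * S = 0.
    rewrite -(subrr (\sum_i q i * lap c (opin p (fun=> 0)) i)).
    rewrite [X in X - _](lap_sym q p csym) -sumrB mulr_sumr.
    by apply: eq_bigr => i _; rewrite lp lq; ring.
  by move/eqP: bS; rewrite mulf_eq0 (gt_eqF S0) orbF => /eqP.
have [K [K0 HK]] := @energy_coercive R _ _ _ anch conn.
have := lerD (HK _ _ p c0_gt0 cc) (HK _ _ q c0_gt0 cc).
rewrite -mulrDr -opprD -mulrDr -!big_split /=.
under [X in _ <= - (_ * X)]eq_bigr do rewrite lp lq.
have -> : \sum_i (p i * (W i * (a * p i - b * q i)) + q i * (W i * (a * q i + b * p i)))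
    = a * S by rewrite mulr_sumr; apply: eq_bigr => i _; ring.
set P := \sum_i _ => H.
have P0 : 0 < P.
  have t0 i : 0 <= p i ^+ 2 + q i ^+ 2 by rewrite addr_ge0// sqr_ge0.
  rewrite /P (bigD1 i0)//= ltr_pwDl ?sumr_ge0//.
  rewrite lt_neqAle addr_ge0 ?sqr_ge0// andbT eq_sym paddr_eq0 ?sqr_ge0//.
  by rewrite !sqrf_eq0 negb_and.
have : K * (a * S) < 0.
  by rewrite -oppr_gt0; apply: lt_le_trans H; exact: mulr_gt0.
by rewrite pmulr_rlt0// pmulr_llt0.
Qed.

(** Eigenvectors are rows, so [v] is a left eigenvector. The Jacobian is the Laplacian with row [i]
    divided by [W i]; dividing [v] by [W] and using symmetry gives the equations of
    [lap_pencil_eigenvalue]. *)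
Lemma steady_lin_stable (z : 'I_m -> R) (del g : R) x :
  (forall k l, adj k l = adj l k) -> 0 <= del -> 0 <= g ->
  g * (zealot_bound z + zealot_bound z) ^+ 2 <= sigm 1 / 4 ->
  steady_state adj g del z x -> lin_stable adj g del z x.
Proof.
move=> adjC del0 g0 gB st lam /eigenvalueP[v vJ v0].
pose c := secant adj g del (opin x z) (opin x z).
pose W i := \sum_l infl adj g del (lshift m i) l (opin x z (lshift m i)) (opin x z l).
have W0 i : 0 < W i := weight_gt0 g del (opin x z) anch conn i.
have Wn i : W i != 0 := lt0r_neq0 (W0 i).
have XB := steady_bounded adjC anch conn st.
have cc : conductance adj (sigm 1 / 2) c by exact: (secant_conductance adjC g0 del0 gB XB XB).
pose p i := complex.Re (v ord0 i) / W i; pose q i := complex.Im (v ord0 i) / W i.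
have lapJ (u : 'I_n -> R) j :
    lap c (opin (fun i => u i / W i) (fun=> 0)) j =
    \sum_i u i * jacobianP adj g del z x i j.
  transitivity (\sum_i (i == j)%:R * lap c (opin (fun i => u i / W i) (fun=> 0)) i).
    rewrite (bigD1 j)//= eqxx mul1r big1 ?addr0// => i /negPf ->.
    by rewrite mul0r.
  rewrite (lap_sym _ _ cc.1); apply: eq_bigr => i _.
  by rewrite (jacobianP_steady anch conn st) -/c -/(W i) mulrAC mulrA.
have vE j : \sum_i v ord0 i * Complex (jacobianP adj g del z x i j) 0 = lam * v ord0 j.
  have /rowP/(_ j) := vJ; rewrite !mxE => <-.
  by apply: eq_bigr => i _; rewrite [in RHS]mxE.
have lp i : lap c (opin p (fun=> 0)) i =
    W i * (complex.Re lam * p i - complex.Im lam * q i).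
  have := congr1 (@complex.Re R) (vE i); rewrite raddf_sum lapJ.
  have -> : W i * (complex.Re lam * p i - complex.Im lam * q i) =
      complex.Re (lam * v ord0 i).
    rewrite /p /q; case: (lam) (v ord0 i) => [a b] [s t] /=.
    by field; exact: Wn.
  move=> <-; apply: eq_bigr => a _.
  by case: (v ord0 a) => s t /=; rewrite mulr0 subr0.
have lq i : lap c (opin q (fun=> 0)) i =
    W i * (complex.Re lam * q i + complex.Im lam * p i).
  have := congr1 (@complex.Im R) (vE i); rewrite raddf_sum lapJ.
  have -> : W i * (complex.Re lam * q i + complex.Im lam * p i) =
      complex.Im (lam * v ord0 i).
    rewrite /p /q; case: (lam) (v ord0 i) => [a b] [s t] /=.
    by field; exact: Wn.
  move=> <-; apply: eq_bigr => a _.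
  by case: (v ord0 a) => s t /=; rewrite mulr0 add0r.
have pq0 : exists i, (p i != 0) || (q i != 0).
  have /rV0Pn[i vi0] := v0; exists i; apply: contra_neqT vi0.
  rewrite negb_or !negbK /p /q !mulf_eq0 invr_eq0 (negPf (Wn i)) !orbF.
  by case: (v ord0 i) => s t /= /andP[/eqP-> /eqP->].
have c0 : 0 < sigm 1 / 2 :> R by rewrite divr_gt0// sigm_gt0.
have [b0 a0] := lap_pencil_eigenvalue c0 cc lp lq pq0 W0.
(* In the order of [R[i]], [lam < 0] means zero imaginary part and negative real part. *)
by rewrite ltcE /= b0 eqxx.
Qed.

End LinearStability.

(** * Smooth dependence of the steady state on gamma *)

Section Branch.
Variables (R : realType) (n m : nat) (adj : rel 'I_(n + m)).
Hypothesis adjC : forall k l, adj k l = adj l k.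
Hypothesis anch : anchored adj.
Hypothesis conn : persuadable_connected adj.
Variables (z : 'I_m -> R) (del : R).
Hypothesis del0 : 0 <= del.
Variables (eps : R).
Hypothesis epsB : forall g, 0 <= g < eps ->
  g * (zealot_bound z + zealot_bound z) ^+ 2 <= sigm 1 / 4.
Variable h : R -> 'I_n -> R.
Hypothesis hst : forall g, 0 <= g < eps -> steady_state adj g del z (h g).

Let c0 : R := sigm 1 / 2.
Let c0_gt0 : 0 < c0. Proof. by rewrite divr_gt0// sigm_gt0. Qed.
Let H g := opin (h g) z.

Let hB g : 0 <= g < eps -> forall k, `|H g k| <= zealot_bound z.
Proof. by move=> /hst; exact: steady_bounded. Qed.

Let hforce g : 0 <= g < eps -> forall i, force adj g del (H g) i = 0.
Proof. by move=> /hst/(steady_stateP _ _ _ _ anch conn). Qed.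

Let hcc g g' : 0 <= g < eps -> 0 <= g' < eps ->
  conductance adj c0 (secant adj g' del (H g') (H g)).
Proof.
move=> gI gI'; have /andP[g0' _] := gI'.
exact: (secant_conductance adjC g0' del0 (epsB gI') (hB gI') (hB gI)).
Qed.

(** Both forces vanish on the branch; changing the opinions and the parameter separately splits
    their difference into a Laplacian of the increment and a drift. *)
Let lap_increment g g' : 0 <= g < eps -> 0 <= g' < eps -> forall i,
  lap (secant adj g' del (H g') (H g)) (opin (fun a => h g' a - h g a) (fun=> 0)) i =
  (g' - g) * - drift adj g' g del (H g) i.
Proof.
move=> gI gI' i; rewrite -force_opinB -/(H g') -/(H g) hforce// sub0r.
by rewrite mulrN -force_drift (hforce gI) subr0.
Qed.

Section Limits.
Variables (T : Type) (F : set_system T) (FF : Filter F).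
Variables (gs : T -> R) (g : R).
Hypothesis gI : 0 <= g < eps.
Hypothesis gsI : \forall s \near F, 0 <= gs s < eps.
Hypothesis gsg : gs s @[s --> F] --> g.

(** The data of the increment system carry the factor [gs s - g], which tends to 0. The general
    filter serves both [s] in the interval and the shifted [t + s]. *)
Lemma cvg_branch i : h (gs s) i @[s --> F] --> h g i.
Proof.
suff d0 : h (gs s) i - h g i @[s --> F] --> 0 by exact: (cvg_sub0 d0 (cvg_cst (h g i))).
pose rs s j := (gs s - g) * - drift adj (gs s) g del (H g) j.
apply: (lap_solution_cvg0 anch conn FF (rs := rs) (ds := fun s a => h (gs s) a - h g a)
  (cs := fun s => secant adj (gs s) del (H (gs s)) (H g)) c0_gt0).
  by apply: filterS gsI => s sI; split; [exact: hcc | exact: lap_increment].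
move=> j; rewrite -(mul0r (- drift adj g g del (H g) j)) -(subrr g).
apply: cvgM; first by apply: cvgB => //; exact: cvg_cst.
by apply: cvgN; apply: cvg_drift => // [|k]; exact: cvg_cst.
Qed.

Lemma cvg_branch_opin k : H (gs s) k @[s --> F] --> H g k.
Proof.
rewrite /H /opin; case: fintype.split => [a|b]; last exact: cvg_cst.
exact: cvg_branch.
Qed.

End Limits.

(** Implicit differentiation: [h'] solves the linearised system. Its continuity and the convergence
    of the difference quotients both follow from [lap_solution_cvg]. *)
Lemma branch_C1 : C1_on_Ico eps h.
Proof.
have /boolp.choice[h' Hh'] : forall g, exists p, 0 <= g < eps ->
    forall i, lap (secant adj g del (H g) (H g)) (opin p (fun=> 0)) i =
              - drift adj g g del (H g) i.
  (* Outside the interval 0 is a mere default. *)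
  move=> g; case: (boolP (0 <= g < eps)) => gI; last by exists (fun=> 0).
  by have [p Hp] := lap_surj (fun i => - drift adj g g del (H g) i) anch conn c0_gt0
    (hcc gI gI); exists p.
exists h'; split=> [i|i t tI].
  apply/subspace_continuousP => t /= tI.
  set F := within _ _; have FF : Filter F by exact: within_filter.
  have FI : \forall s \near F, 0 <= s < eps by exact: near_withinT.
  have Ft : s @[s --> F] --> t by exact: cvg_within.
  have HF := cvg_branch_opin FF tI FI Ft.
  apply: (lap_solution_cvg anch conn FF (ps := h')
    (rs := fun s j => - drift adj s s del (H s) j)
    (cs := fun s => secant adj s del (H s) (H s)) c0_gt0 _ _ _ (Hh' t tI)).
  - by apply: filterS FI => s sI; split; [exact: hcc | exact: Hh'].
  - by move=> k l; exact: cvg_secant.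
  - by move=> j; apply: cvgN; apply: cvg_drift.
set F := within _ _; have FF : Filter F by exact: within_filter.
have FI : \forall s \near F, s != 0 /\ 0 <= t + s < eps by exact: near_withinT.
have FI' : \forall s \near F, 0 <= t + s < eps by apply: filterS FI => s [].
have Ft : t + s @[s --> F] --> t.
  by rewrite -[X in _ --> X]addr0; apply: cvgD; [exact: cvg_cst | exact: cvg_within].
have HF := cvg_branch_opin FF tI FI' Ft.
(* The quotient solves the increment system between [t] and [t + s], divided by [s]. *)
apply: (lap_solution_cvg anch conn FF (ps := fun s a => (h (t + s) a - h t a) / s)
    (rs := fun s j => - drift adj (t + s) t del (H t) j)
    (cs := fun s => secant adj (t + s) del (H (t + s)) (H t)) c0_gt0 _ _ _ (Hh' t tI)).
- apply: filterS FI => s [s0 sI]; split=> [|j]; first exact: hcc.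
  have -> : (fun a => (h (t + s) a - h t a) / s) =
            (fun a => s^-1 * (h (t + s) a - h t a)).
    by apply/funext => a; rewrite mulrC.
  by rewrite lapZ lap_increment// addrAC subrr add0r mulKf.
- by move=> k l; apply: cvg_secant => // k'; exact: cvg_cst.
- by move=> j; apply: cvgN; apply: cvg_drift => // [|k]; exact: cvg_cst.
Qed.

End Branch.

(** * Choice of the radius [eps] and assembly of the branch *)

Theorem theorem1 (R : realType) (n m : nat) (adj : rel 'I_(n + m))
  (z : 'I_m -> R) (delta : R) (xbar : 'I_n -> R) :
  simple_graph adj ->
  (0 < m)%N ->
  persuadable_connected adj ->
  0 <= delta ->
  steady_state adj 0 delta z xbar ->
  (forall y : 'I_n -> R, steady_state adj 0 delta z y -> y = xbar) ->
  exists eps : R, 0 < eps /\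
    exists h : R -> 'I_n -> R,
      (C1_on_Ico eps h /\
       h 0 = xbar /\
       (forall gam : R, 0 <= gam < eps ->
          steady_state adj gam delta z (h gam) /\
          (forall y : 'I_n -> R, steady_state adj gam delta z y -> y = h gam) /\
          lin_stable adj gam delta z (h gam))) /\
      (forall h2 : R -> 'I_n -> R,
         C1_on_Ico eps h2 ->
         h2 0 = xbar ->
         (forall gam : R, 0 <= gam < eps ->
            steady_state adj gam delta z (h2 gam) /\
            (forall y : 'I_n -> R, steady_state adj gam delta z y -> y = h2 gam) /\
            lin_stable adj gam delta z (h2 gam)) ->
         forall gam : R, 0 <= gam < eps -> h2 gam = h gam).
Proof.
move=> [adjC _] _ conn del0 st0 uniq0.
(* Uniqueness at gamma 0 yields an edge between a persuadable node and a zealot. *)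
have anch := steady_unique_anchored conn.1 st0 uniq0.
pose M := (zealot_bound z + zealot_bound z) ^+ 2.
have M0 : 0 <= M by exact: sqr_ge0.
have w0 := sigm_gt0 (1 : R).
(* Chosen so that [g * M <= sigm 1 / 4] for [g] below [eps]; adding 1 avoids a division by zero when
   all zealot opinions are 0. *)
pose eps := sigm 1 / 4 / (M + 1).
have eps0 : 0 < eps by rewrite !divr_gt0// ltr_wpDl.
have epsB g : 0 <= g < eps -> g * M <= sigm 1 / 4.
  move=> /andP[g0]; rewrite ltr_pdivlMr ?ltr_wpDl// => H; nra.
have /boolp.choice[h hst] : forall g, exists x, 0 <= g < eps ->
    steady_state adj g delta z x.
  move=> g; case: (boolP (0 <= g < eps)) => gI; last by exists xbar.
  have /andP[g0 _] := gI.
  by have [x] := steady_exists adjC anch conn del0 g0 (epsB g gI); exists x.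
have huniq g : 0 <= g < eps -> forall y, steady_state adj g delta z y -> y = h g.
  move=> gI y sty; have /andP[g0 _] := gI.
  exact: (steady_unique adjC anch conn del0 g0 (epsB g gI) sty (hst g gI)).
exists eps; split=> //; exists h; split; last first.
  (* A competitor takes steady states as values, so it agrees pointwise with [h]. *)
  by move=> h2 _ _ H2 g gI; apply: huniq => //; have [] := H2 g gI.
split; first exact: (branch_C1 adjC anch conn del0 epsB hst).
split; first by apply: uniq0; apply: hst; rewrite lexx.
move=> g gI; have /andP[g0 _] := gI; split; first exact: hst.
split; first exact: huniq.
exact: (steady_lin_stable anch conn adjC del0 g0 (epsB g gI) (hst g gI)).
Qed.
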